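(* Let $n\in\overline{\mathbb N}_+$. Then for every $\rho\in\mathcal P(\mathcal P(S))$ the $n$-th moment measure of $\check T(\rho)$ is given by $$\check T(\rho)^{(n)}=T^{(n)}(\rho^{(n)}).$$
   Context: Notation: $\mathbb N=\{0,1,2,\ldots\}$, $\overline{\mathbb N}=\mathbb N\cup\{\infty\}$, $\mathbb N_+=\{1,2,\ldots\}$, $\overline{\mathbb N}_+=\mathbb N_+\cup\{\infty\}$. For a Polish space $E$, $\mathcal P(E)$ is the space of Borel probability measures on $E$ with the topology of weak convergence (which is again Polish) and its Borel $\sigma$-field. $E^0$ is a one-point space and $E^\infty$ is the space of infinite sequences in $E$ with the product topology. Setting: $S$ and $\Omega$ are Polish spaces, $r$ is a Borel probability measure on $\Omega$, $\kappa:\Omega\to\overline{\mathbb N}$ is measurable, $\Omega_k:=\{\omega:\kappa(\omega)=k\}$, and $\gamma$ assigns to each $\omega\in\Omega$ a map $\gamma[\omega]:S^{\kappa(\omega)}\to S$ such that for each $k\in\overline{\mathbb N}$ the map $\Omega_k\times S^k\ni(\omega,x)\mapsto\gamma[\omega](x)\in S$ is jointly measurable. For measurable $g:E^k\to E$ and $\mu\in\mathcal P(E)$, $T_g(\mu)$ is the law of $g(X_1,\ldots,X_k)$ where $X_1,\ldots,X_k$ are i.i.d. with law $\mu$ (infinitely many $X_i$ if $k=\infty$). $n$-variate maps: for $n\in\overline{\mathbb N}_+$ and measurable $g:S^k\to S$, define $g^{(n)}:(S^n)^k\to S^n$ by $g^{(n)}(x):=(g(x^1),\ldots,g(x^n))$,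 where $x=(x_i^j)_{i=1,\ldots,k}^{j=1,\ldots,n}$ and $x^j:=(x^j_1,\ldots,x^j_k)$ (with the obvious modification if $n$ or $k$ is $\infty$). Then $T^{(n)}(\nu):=\int_\Omega r(d\omega)\,T_{\gamma[\omega]^{(n)}}(\nu)$ for $\nu\in\mathcal P(S^n)$. Higher-level map: for measurable $g:S^k\to S$, $\check g:\mathcal P(S)^k\to\mathcal P(S)$ is the map such that $\check g(\mu_1,\ldots,\mu_k)$ is the image of the product measure $\mu_1\otimes\cdots\otimes\mu_k$ under $g$. The higher-level map $\check T:\mathcal P(\mathcal P(S))\to\mathcal P(\mathcal P(S))$ is $\check T(\rho):=\int_\Omega r(d\omega)\,T_{\check g_\omega}(\rho)$ with $g_\omega:=\gamma[\omega]$. Moment measures: for $\rho\in\mathcal P(\mathcal P(S))$ and $n\in\overline{\mathbb N}_+$, the $n$-th moment measure $\rho^{(n)}\in\mathcal P(S^n)$ is the law of $(X^1,\ldots,X^n)$ where, for a $\mathcal P(S)$-valued random variable $\xi$ with law $\rho$, conditionally on $\xi$ the $X^1,\ldots,X^n$ are independent with law $\xi$ (an infinite sequence if $n=\infty$). *)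

(* Defs.v *)
From HB Require Import structures.
From mathcomp Require Import all_boot all_order all_algebra.
From mathcomp Require Import all_classical all_reals all_analysis.

Set Implicit Arguments.
Unset Strict Implicit.
Unset Printing Implicit Defensive.

Import Order.TTheory GRing.Theory Num.Theory.
Import numFieldNormedType.Exports.

Local Open Scope classical_set_scope.
Local Open Scope ring_scope.

Definition separable (E : topologicalType) : Prop :=
  exists2 D : set E, countable D & dense D.

Definition completely_metrizable (R : realType) (E : topologicalType) : Prop :=
  exists (M : metricType R) (f : E -> M) (g : M -> E),
    [/\ cancel f g, cancel g f, continuous f, continuous g &
        forall F : set_system M, ProperFilter F -> cauchy F ->
          exists x : M, F --> x].

Definition polish (R : realType) (E : topologicalType) : Prop :=
  separable E /\ completely_metrizable R E.

Definition borel (E : ptopologicalType) := g_sigma_algebraType (@open E).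

HB.instance Definition _ (E : ptopologicalType) := Measurable.on (borel E).

Definition cbfun (R : realType) (E : ptopologicalType) :=
  {f : E -> R | continuous f /\ exists M : R, forall x, `|f x| <= M}.

Definition cbint (R : realType) (E : ptopologicalType)
    (mu : probability (borel E) R) : {ptws cbfun R E -> R} :=
  fun f => \int[mu]_x (sval f x).

(** The elements are Borel probability measures; the topology is the coarsest
    one making [mu |-> \int f dmu] continuous for every bounded continuous [f],
    i.e., the topology of weak convergence. As everywhere in the library, two
    probabilities may agree on all Borel sets and differ on other sets; such
    pairs are not separated by the topology, nor by its Borel sets. *)
Definition Prob (R : realType) (E : ptopologicalType) :=
  initial_topology (@cbint R E).

HB.instance Definition _ (R : realType) (E : ptopologicalType) :=
  PointedTopological.on (Prob R E).

(** The Borel probability measure with the values prescribed by [m] on Borel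
    sets. Such a measure is unique up to its values on non-Borel sets, and one
    representative is selected as a function of the Borel values of [m] only;
    the result is meaningless if [m] does not restrict to a probability. *)
Definition prob_of (R : realType) (E : ptopologicalType)
    (m : set (borel E) -> \bar R) : probability (borel E) R :=
  get [set pi : probability (borel E) R |
        forall A, measurable A -> pi A = m A].

(** [\int r(dw) K(w)] *)
Definition mixture (R : realType) (W E : ptopologicalType)
    (r : probability (borel W) R) (K : W -> probability (borel E) R) :
    probability (borel E) R :=
  prob_of (fun A => \int[r]_w K w A)%E.

(** [Some n] is the natural number [n]; [None] is infinity. *)
Definition enat := option nat.

HB.instance Definition _ := Pointed.on enat.
HB.instance Definition _ := @isMeasurable.Build default_measure_display
  enat discrete_measurable discrete_measurable0
  discrete_measurableC discrete_measurableU.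

Definition index (k : enat) : countType := if k is Some n then 'I_n else nat.

Definition pow (E : ptopologicalType) (k : enat) : Type :=
  {ptws index k -> E}.

HB.instance Definition _ (E : ptopologicalType) (k : enat) :=
  Topological.on (pow E k).
HB.instance Definition _ (E : ptopologicalType) (k : enat) :=
  isPointed.Build (pow E k) (fun=> point).

(** Product measure of [mu i], [i] in [index k], characterized by its values on
    the measurable rectangles with finitely many nontrivial sides. *)
Definition prod_prob (R : realType) (E : ptopologicalType) (k : enat)
    (mu : index k -> probability (borel E) R) :
    probability (borel (pow E k)) R :=
  get [set pi : probability (borel (pow E k)) R |
        forall (J : seq (index k)) (A : index k -> set (borel E)),
          uniq J -> (forall i, measurable (A i)) ->
          pi [set x | forall i, i \in J -> A i (x i)] =
          (\prod_(i <- J) mu i (A i))%E].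

Definition iid (R : realType) (E : ptopologicalType) (k : enat)
    (mu : probability (borel E) R) : probability (borel (pow E k)) R :=
  prod_prob (fun _ : index k => mu).

(** [T_g(mu)]: the law of [g (X_1, ..., X_k)] for i.i.d. [X_i] of law [mu]. *)
Definition Tmap (R : realType) (E : ptopologicalType) (k : enat)
    (g : pow E k -> E) (mu : probability (borel E) R) :
    probability (borel E) R :=
  prob_of (pushforward (iid k mu) (g : borel (pow E k) -> borel E)).

(** [g^(n)]; [x i j] is the coordinate written [x_i^j], so that row [j] of the
    result is [g (x_1^j, ..., x_k^j)]. *)
Definition nvariate (S : ptopologicalType) (n k : enat) (g : pow S k -> S) :
    pow (pow S n) k -> pow S n :=
  fun x j => g (fun i => x i j).

(** [\check g (mu_1, ..., mu_k)]: the image of [mu_1 (x) ... (x) mu_k] under [g] *)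
Definition higher (R : realType) (S : ptopologicalType) (k : enat)
    (g : pow S k -> S) : pow (Prob R S) k -> Prob R S :=
  fun mu => prob_of (pushforward (prod_prob mu) (g : borel (pow S k) -> borel S)).

Section rtp.
Context (R : realType) (S Omega : ptopologicalType).
Variable (r : probability (borel Omega) R).
Variable (kappa : Omega -> enat) (gamma : forall w, pow S (kappa w) -> S).

(** The map [(w, x) |-> gamma w x] on [Omega_k * S^k]; its value outside of
    that set is irrelevant. *)
Definition gamma_at (k : enat) (p : Omega * pow S k) : S :=
  match pselect (kappa p.1 = k) with
  | left e => gamma (ecast l (pow S l) (esym e) p.2)
  | right _ => point
  end.

Definition jointly_measurable : Prop :=
  forall k : enat,
    measurable_fun ([set w : borel Omega | kappa w = k] `*`
                    [set: borel (pow S k)])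
      (@gamma_at k : borel Omega * borel (pow S k) -> borel S).

(** [T^(n)] *)
Definition Tn (n : enat) (nu : probability (borel (pow S n)) R) :
    probability (borel (pow S n)) R :=
  mixture r (fun w => Tmap (nvariate (gamma (w := w))) nu).

(** [\check T] *)
Definition Tcheck (rho : probability (borel (Prob R S)) R) :
    probability (borel (Prob R S)) R :=
  mixture r (fun w => Tmap (higher (gamma (w := w))) rho).

End rtp.

(** [rho^(n)]: given [xi] of law [rho], the [X^i] are i.i.d. of law [xi], so that
    the law of [(X^1, ..., X^n)] is the [rho]-mixture of the laws [iid n xi]. *)
Definition moment (R : realType) (S : ptopologicalType) (n : enat)
    (rho : probability (borel (Prob R S)) R) :
    probability (borel (pow S n)) R :=
  mixture rho (fun xi : Prob R S => iid n xi).

(* Main.v *)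
(* Proof idea.  Both sides are integrals over [r], so it suffices to compare them
   for one measurable map [g : S^k -> S].  Given [mu_1, ..., mu_k], sample an array
   with independent rows, row [i] being i.i.d. of law [mu_i].  Its columns are then
   i.i.d. of law [mu_1 (x) ... (x) mu_k], so that applying [g] to each column gives
   a sample from the [n]-fold power of [\check g (mu_1, ..., mu_k)].  If the [mu_i]
   are themselves i.i.d. of law [rho], the rows become i.i.d. of law [rho^(n)], and
   applying [g] columnwise gives [T_(g^(n)) (rho^(n))].

   Two facts have to be established for this.  Infinite product measures exist:
   if a box were covered by boxes of smaller total volume, one could fix the
   coordinates one at a time keeping this strict inequality for the sections, and
   the resulting point would lie in the box but in none of the covering ones.  The
   Borel sigma-algebra of [P(S)] is generated by the evaluations [mu |-> mu A]: the
   weak topology has a countable subbase, because every nonnegative lower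
   semicontinuous function on [S] is a supremum of countably many functions
   [x |-> max (0, p - q d(x, a))]. *)

Require Import Defs.
From HB Require Import structures.
From mathcomp Require Import all_boot all_order all_algebra.
From mathcomp Require Import all_classical all_reals all_analysis.
From mathcomp Require Import measurable_realfun giry lra.

Set Implicit Arguments.
Unset Strict Implicit.
Unset Printing Implicit Defensive.

Import Order.TTheory GRing.Theory Num.Theory.
Import numFieldNormedType.Exports.
(* [Defs.index] would otherwise be shadowed by [seq.index]. *)
Import Defs.

Local Open Scope classical_set_scope.
Local Open Scope ring_scope.

(** * Product measures *)

Lemma emeasurable_prod (d : measure_display) (X : measurableType d) (R : realType)
    (I : Type) (J : seq I) (f : I -> X -> \bar R) :
  (forall i, measurable_fun setT (f i)) ->
  measurable_fun setT (fun x => \prod_(i <- J) f i x)%E.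
Proof.
move=> mf; elim: J => [|j J ih].
  by under eq_fun do rewrite big_nil; exact: measurable_cst.
by under eq_fun do rewrite big_cons; exact: emeasurable_funM.
Qed.

(* All sets are measurable, so that [mu_ext] applies to the volume of boxes,
   extended by [+oo] to all other sets. *)
Definition boxspace (I T : Type) : Type := I -> T.

HB.instance Definition _ (I : Type) (T : pointedType) :=
  Pointed.copy (boxspace I T) (I -> T).
HB.instance Definition _ (I : Type) (T : pointedType) :=
  @isMeasurable.Build default_measure_display
  (boxspace I T) discrete_measurable discrete_measurable0
  discrete_measurableC discrete_measurableU.

Section upd.
Context (I : eqType) (T : Type).

Definition upd (t : I -> T) (i : I) (y : T) : I -> T :=
  fun j => if j == i then y else t j.

Lemma upd_same t i y : upd t i y i = y.
Proof. by rewrite /upd eqxx. Qed.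

Lemma upd_other t i y j : j != i -> upd t i y j = t j.
Proof. by rewrite /upd => /negbTE ->. Qed.

End upd.

Section box.
Local Open Scope ereal_scope.
Context (d : measure_display) (T : measurableType d) (R : realType).
Context (I : countType).
Variable mu : I -> probability T R.

(* [None] codes the empty box, which has no other code if [I] is empty. *)
Definition boxcode : Type := option (seq I * (I -> set T)).

Definition valid (c : boxcode) : Prop :=
  if c is Some (J, A) then uniq J /\ forall i, measurable (A i) else True.

Definition box (c : boxcode) : set (I -> T) :=
  if c is Some (J, A) then [set x | forall i, i \in J -> A i (x i)] else set0.

Definition vol (c : boxcode) : \bar R :=
  if c is Some (J, A) then \prod_(i <- J) mu i (A i) else 0.

(* The volume of the section of the box [c] at the coordinates of [t] whose
   code is less than [n]. *)
Definition svol (n : nat) (t : I -> T) (c : boxcode) : \bar R :=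
  if c is Some (J, A) then
    \prod_(i <- J) (if (pickle i < n)%N then (\1_(A i) (t i))%:E else mu i (A i))
  else 0.

Lemma svol0 t c : svol 0 t c = vol c.
Proof. by case: c => [[J A]|]. Qed.

Lemma prode_le1 (J : seq I) (f : I -> \bar R) :
  (forall i, 0 <= f i <= 1) -> \prod_(i <- J) f i <= 1.
Proof.
move=> f01; suff /andP[] : 0 <= \prod_(i <- J) f i <= 1 by [].
elim/big_ind : _ => //= [|x y /andP[x0 x1] /andP[y0 y1]].
  by rewrite lexx lee_fin ler01.
by rewrite mule_ge0//= -[leRHS]mule1 lee_pmul.
Qed.

Lemma svol_factor_ge0 n t A i :
  0 <= (if (pickle i < n)%N then (\1_(A i) (t i))%:E else mu i (A i)).
Proof. by case: ifP => // _; rewrite lee_fin. Qed.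

Lemma svol_ge0 n t c : 0 <= svol n t c.
Proof.
by case: c => [[J A]|//]; apply: prode_ge0 => i _; exact: svol_factor_ge0.
Qed.

Lemma svol_le1 n t c : valid c -> svol n t c <= 1.
Proof.
case: c => [[J A] /= [_ mA]|_ /=]; last by rewrite lee_fin.
apply: prode_le1 => i.
rewrite svol_factor_ge0 /=; case: ifP => _; last exact: probability_le1.
by rewrite lee_fin indicE; case: (_ \in _) => /=; rewrite ?ler01 ?lexx.
Qed.

Lemma vol_ge0 c : 0 <= vol c.
Proof. by rewrite -(svol0 (fun=> point)) svol_ge0. Qed.

Lemma svol_indic n t J A : (forall i, i \in J -> (pickle i < n)%N) ->
  svol n t (Some (J, A)) = (\1_(box (Some (J, A))) t)%:E.
Proof.
move=> Jn; rewrite indicE; have [tbox|tbox] := pselect (box (Some (J, A)) t).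
  rewrite mem_set//= big_seq big1// => i iJ.
  by rewrite Jn// indicE mem_set//; exact: tbox.
rewrite memNset//=; move/existsNP : tbox => [i /not_implyP[iJ Ait]].
rewrite (big_rem i)//= Jn// indicE memNset// mul0e//.
Qed.

(** As [J] has no repetitions, at most one factor depends on [y], and the integral of its indicator
    is the factor [mu i (A i)] of the previous stage. *)
Lemma svol_integral i t c : valid c ->
  \int[mu i]_y svol (pickle i).+1 (upd t i y) c = svol (pickle i) t c.
Proof.
case: c => [[J A] [uJ mA]|_] /=; last by rewrite integral0.
have E j y : j != i ->
    (if (pickle j < (pickle i).+1)%N then (\1_(A j) (upd t i y j))%:E else mu j (A j)) =
    (if (pickle j < pickle i)%N then (\1_(A j) (t j))%:E else mu j (A j)).
  move=> ji; rewrite upd_other// ltnS leq_eqVlt.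
  by rewrite (inj_eq (pcan_inj (@pickleK I))) (negbTE ji).
have [iJ|iJ] := boolP (i \in J); last first.
  under eq_integral => y _.
    rewrite big_seq (eq_bigr (fun j =>
      if (pickle j < pickle i)%N then (\1_(A j) (t j))%:E else mu j (A j))).
      rewrite -big_seq; over.
    move=> j jJ; apply: E; apply: contraNneq iJ => <-//.
  by rewrite integral_cst//= probability_setT mule1.
under eq_integral => y _.
  rewrite (bigD1_seq i)//= ltnSn upd_same.
  rewrite (eq_bigr (fun j =>
      if (pickle j < pickle i)%N then (\1_(A j) (t j))%:E else mu j (A j))); last first.
    by move=> j ji; exact: E.
  rewrite muleC.
  over.
rewrite ge0_integralZl//; last 2 first.
- by apply/measurable_EFinP; exact: measurable_indic.
- apply: prode_ge0 => j _; exact: svol_factor_ge0.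
by rewrite integral_indic// setIT [RHS](bigD1_seq i)//= ltnn muleC.
Qed.

Lemma measurable_svol n i t c : valid c ->
  measurable_fun setT (fun y => svol n (upd t i y) c).
Proof.
case: c => [[J A] [uJ mA]|_] /=; last exact: measurable_cst.
apply: emeasurable_prod => j.
case: (pickle j < n)%N; last exact: measurable_cst.
apply/measurable_EFinP; rewrite /upd.
case: eqP => [->|_]; last exact: measurable_cst.
exact: measurable_indic.
Qed.

(** If every value of the coordinate of code [n] reversed the inequality, then integrating over that
    coordinate and exchanging sum and integral would reverse it at stage [n] as well. A code that no
    index bears changes nothing. *)
Let halmos_step n (c0 : boxcode) (c : nat -> boxcode) t :
  valid c0 -> (forall m, valid (c m)) ->
  \sum_(m <oo) svol n t (c m) < svol n t c0 ->
  exists2 t', (forall i, pickle i <> n -> t' i = t i) &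
    \sum_(m <oo) svol n.+1 t' (c m) < svol n.+1 t' c0.
Proof.
move=> vc0 vc lt_n.
have [[i ni]|no_i] := pselect (exists i : I, pickle i = n); last first.
  exists t => //; have E c' : svol n.+1 t c' = svol n t c'.
    case: c' => [[J A]|//] /=; apply: eq_bigr => i _.
    rewrite ltnS leq_eqVlt; case: eqP => // ni; case: no_i; by exists i.
  by under eq_eseriesr do rewrite E; rewrite E.
move: lt_n; rewrite -ni => lt_n.
apply: contrapT => no_t'.
have le_y y : svol (pickle i).+1 (upd t i y) c0 <=
    \sum_(m <oo) svol (pickle i).+1 (upd t i y) (c m).
  rewrite leNgt; apply/negP => lt_y; apply: no_t'; exists (upd t i y) => // j ji.
  by rewrite upd_other//; apply: contra_not_neq ji => ->.
move: lt_n; apply/negP; rewrite -leNgt -svol_integral//.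
under eq_eseriesr do rewrite -svol_integral//.
rewrite -integral_nneseries//; last 2 first.
- by move=> m; exact: measurable_svol.
- by move=> m y _; exact: svol_ge0.
apply: ge0_le_integral => //.
- by move=> y _; exact: svol_ge0.
- exact: measurable_svol.
- apply: ge0_emeasurable_sum => // [m y _ _|m _].
    exact: svol_ge0.
  exact: measurable_svol.
Qed.

Lemma vol_le_nneseries (c0 : boxcode) (c : nat -> boxcode) :
  valid c0 -> (forall m, valid (c m)) -> box c0 `<=` \bigcup_m box (c m) ->
  vol c0 <= \sum_(m <oo) vol (c m).
Proof.
move=> vc0 vc c0c; rewrite leNgt; apply/negP => lt0.
(* The last clause is an implication so that every state has a successor, as dependent choice
   requires; [lt0] starts the chain. *)
pose next (a b : nat * (I -> T)) := [/\ b.1 = a.1.+1,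
  forall i, pickle i <> a.1 -> b.2 i = a.2 i &
  \sum_(m <oo) svol a.1 a.2 (c m) < svol a.1 a.2 c0 ->
  \sum_(m <oo) svol b.1 b.2 (c m) < svol b.1 b.2 c0].
have [|u [u0 uS]] := @dependent_choice _ next _ (0%N, fun=> point).
  move=> [n t]; apply/cid.
  have [lt|nlt] := pselect (\sum_(m <oo) svol n t (c m) < svol n t c0).
    have [t' t't lt'] := halmos_step vc0 vc lt.
    by exists (n.+1, t').
  by exists (n.+1, t).
have un n : (u n).1 = n.
  by elim: n => [|n ih]; [rewrite u0|have [-> _ _] := uS n; rewrite ih].
have lt n : \sum_(m <oo) svol n (u n).2 (c m) < svol n (u n).2 c0.
  elim: n => [|n ih].
    by under eq_eseriesr do rewrite svol0; rewrite svol0.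
  by have [_ _] := uS n; rewrite !un; exact.
(* Stage [n] alters only the coordinate of code [n], so the points stabilise coordinatewise to the
   [t] defined below. *)
have ustab i n : (pickle i < n)%N -> (u n).2 i = (u (pickle i).+1).2 i.
  elim: n => // n ih; rewrite ltnS leq_eqVlt => /predU1P[->//|lt_in].
  have [_ st _] := uS n; rewrite st ?ih// un => ni.
  by rewrite ni ltnn in lt_in.
pose t i := (u (pickle i).+1).2 i.
have ut n c' : svol n (u n).2 c' = svol n t c'.
  case: c' => [[J A]|//] /=; apply: eq_bigr => i _.
  by case: ifP => // ni; rewrite /t ustab.
have {}lt n : \sum_(m <oo) svol n t (c m) < svol n t c0.
  by rewrite -ut; under eq_eseriesr do rewrite -ut; exact: lt.
(* A box restricts finitely many coordinates. Once they are all fixed, its section has volume 1 or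
   0, according to whether [t] lies in it. *)
have bound c' : exists N, forall n, (N <= n)%N -> svol n t c' = (\1_(box c') t)%:E.
  case: c' => [[J A]|]; last by exists 0%N => n _; rewrite /= indic0.
  exists (\max_(i <- J) (pickle i).+1)%N => n Jn; apply: svol_indic => i iJ.
  by apply: leq_trans Jn; exact: (leq_bigmax_seq (F := fun i => (pickle i).+1)).
have sum_ge0 n : 0 <= \sum_(m <oo) svol n t (c m).
  by apply: nneseries_ge0 => m _ _; exact: svol_ge0.
have [N0 svol_c0] := bound c0.
have tc0 : box c0 t.
  apply: contrapT => nt; have := lt N0; rewrite svol_c0// indicE memNset//=.
  by rewrite ltNge sum_ge0.
have [m _ tcm] := c0c _ tc0.
have [N1 svol_cm] := bound (c m).
(* At stage [N1] the box [c m] alone contributes 1 to the sum, while [svol] of [c0] is at most 1. *)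
have := lt N1; apply/negP; rewrite -leNgt (le_trans (svol_le1 _ _ vc0))//.
rewrite (@le_trans _ _ (svol N1 t (c m)))//.
  by rewrite svol_cm// indicE mem_set.
rewrite (@nneseriesD1 _ _ m)//; last by move=> k _; exact: svol_ge0.
by rewrite leeDl// nneseries_ge0// => k _ _; exact: svol_ge0.
Qed.

Definition boxvol (X : set (boxspace I T)) : \bar R :=
  if pselect (exists c, valid c /\ box c = X) is left e then vol (sval (cid e))
  else +oo.

(** Two codes of the same box cover each other, so [vol_le_nneseries], with covers padded by empty
    boxes, forces equal volumes. *)
Lemma boxvolE c : valid c -> boxvol (box c) = vol c.
Proof.
move=> vc; rewrite /boxvol; case: pselect => [e|[]]; last by exists c.
case: (cid e) => c' /= [vc' c'c].
have le_vol c1 c2 : valid c1 -> valid c2 -> box c1 = box c2 -> vol c1 <= vol c2.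
  move=> v1 v2 c12.
  apply: (@le_trans _ _ (\sum_(m <oo) vol (if m is 0%N then c2 else None))).
    apply: vol_le_nneseries => //; first by case.
    by rewrite c12 => x ?; exists 0%N.
  rewrite nneseries_recl//; last by move=> k _; exact: vol_ge0.
  by rewrite eseries0 ?adde0// => -[].
by apply/eqP; rewrite eq_le !le_vol.
Qed.

Lemma boxvol_fin X : boxvol X != +oo -> exists2 c, valid c & box c = X.
Proof. by rewrite /boxvol; case: pselect => [[c []]|]; [exists c|rewrite eqxx]. Qed.

Lemma boxvol_ge0 X : 0 <= boxvol X.
Proof. by rewrite /boxvol; case: pselect => // e; exact: vol_ge0. Qed.

Lemma boxvol0 : boxvol set0 = 0.
Proof. by rewrite (@boxvolE None). Qed.

Definition boxouter : set (boxspace I T) -> \bar R := mu_ext boxvol.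

HB.instance Definition _ := isOuterMeasure.Build R (boxspace I T) boxouter
  (mu_ext0 boxvol0 boxvol_ge0) (mu_ext_ge0 boxvol_ge0) (le_mu_ext boxvol)
  (mu_ext_sigma_subadditive boxvol_ge0).

(** A cover containing a set that is not a box has infinite total weight, so only covers by valid
    codes matter for the infimum. *)
Lemma boxouter_ge (X : set (boxspace I T)) (z : \bar R) :
  (forall c : nat -> boxcode, (forall n, valid (c n)) ->
    X `<=` \bigcup_n box (c n) -> z <= \sum_(n <oo) vol (c n)) ->
  z <= boxouter X.
Proof.
move=> zc; apply: le_ereal_inf_tmp => _ [F [_ XF] <-].
have [[n Fn]|Ffin] := pselect (exists n, boxvol (F n) = +oo).
  by rewrite (eseries_pinfty _ _ Fn) ?leey// => m _;
    rewrite gt_eqF// (lt_le_trans _ (boxvol_ge0 _)).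
have /choice[c cF] : forall n, exists c, valid c /\ box c = F n.
  move=> n; have [|c vc cF] := @boxvol_fin (F n); last by exists c.
  by apply/eqP => Fn; apply: Ffin; exists n.
apply: le_trans (zc c _ _) _.
- by move=> n; have [] := cF n.
- by move=> x /XF[n _ Fx]; exists n => //; have [_ ->] := cF n.
- apply: lee_nneseries => [n _ _|n _]; first exact: vol_ge0.
  by have [vc <-] := cF n; rewrite boxvolE.
Qed.

Lemma boxouter_le (X : set (boxspace I T)) (c : nat -> boxcode) :
  (forall n, valid (c n)) -> X `<=` \bigcup_n box (c n) ->
  boxouter X <= \sum_(n <oo) vol (c n).
Proof.
move=> vc Xc; apply: ereal_inf_lbound; exists (box \o c) => //.
by apply: eq_eseriesr => n _ /=; rewrite boxvolE.
Qed.

Lemma boxouter_box c : valid c -> boxouter (box c) = vol c.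
Proof.
move=> vc; apply/eqP; rewrite eq_le; apply/andP; split; last first.
  by apply: boxouter_ge => c' vc' cc'; exact: vol_le_nneseries.
apply: le_trans (boxouter_le (c := fun n => if n is 0%N then c else None) _ _) _.
- by case.
- by move=> x ?; exists 0%N.
- rewrite nneseries_recl//; last by move=> k _; exact: vol_ge0.
  by rewrite eseries0 ?adde0// => -[].
Qed.

Lemma box_split c (j : I) (B : set T) : valid c -> measurable B ->
  exists c1 c2, [/\ valid c1, valid c2, vol c = vol c1 + vol c2,
    box c `&` [set x | B (x j)] `<=` box c1 &
    box c `&` ~` [set x | B (x j)] `<=` box c2].
Proof.
case: c => [[J A]|]; last first.
  by exists None, None; split => //=; rewrite ?adde0// => x [].
(* The sides of [A] off [J] do not enter the box, so [A0] makes them full before [j] joins the list;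
   a full side has mass 1. Side [j] is then cut by [B] or by its complement. *)
move=> [uJ mA] mB; pose A0 i := if i \in J then A i else setT.
pose A' (D : set T) i := if i == j then A0 i `&` D else A0 i.
pose J' := if j \in J then J else j :: J.
have mA0 i : measurable (A0 i) by rewrite /A0; case: ifP.
have uJ' : uniq J' by rewrite /J'; case: ifPn => //= ->.
have jJ' : j \in J' by rewrite /J'; case: ifPn => //; rewrite mem_head.
have vA' (D : set T) : measurable D -> valid (Some (J', A' D)).
  by move=> mD; split => // i; rewrite /A'; case: ifP => // _; exact: measurableI.
exists (Some (J', A' B)), (Some (J', A' (~` B))); split.
- exact: vA'.
- exact/vA'/measurableC.
- have -> : vol (Some (J, A)) = vol (Some (J', A0)).
    have -> : vol (Some (J, A)) = \prod_(i <- J) mu i (A0 i).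
      by rewrite /= !big_seq; apply: eq_bigr => i iJ; rewrite /A0 iJ.
    rewrite /= /J'; case: ifPn => // jJ.
    by rewrite big_cons /A0 (negbTE jJ) probability_setT mul1e.
  have E D : vol (Some (J', A' D)) =
      mu j (A0 j `&` D) * \prod_(i <- J' | i != j) mu i (A0 i).
    rewrite /= (bigD1_seq j)//= /A' eqxx; congr (_ * _).
    by apply: eq_bigr => i /negbTE ->.
  rewrite !E /= (bigD1_seq j)//= -ge0_muleDl//.
  by rewrite -setDE addeC -measureDI.
- move=> x [xA Bx] i iJ'; rewrite /A' /A0.
  case: eqP => [->|_]; last by case: ifP => // iJ; exact: xA.
  by split => //; case: ifP => // iJ; exact: xA.
- move=> x [xA Bx] i iJ'; rewrite /A' /A0.
  case: eqP => [->|_]; last by case: ifP => // iJ; exact: xA.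
  by split => //; case: ifP => // iJ; exact: xA.
Qed.

(** Splitting every box of a cover of [X] in two yields covers of both parts of [X] with the same
    total volume. *)
Lemma boxouter_caratheodory (j : I) (B : set T) : measurable B ->
  boxouter.-caratheodory [set x : boxspace I T | B (x j)].
Proof.
move=> mB; apply: le_caratheodory_measurable => X.
apply: boxouter_ge => c vc Xc.
have /choice[c1 /choice[c2 c12]] : forall n, exists c1 c2,
    [/\ valid c1, valid c2, vol (c n) = vol c1 + vol c2,
    box (c n) `&` [set x | B (x j)] `<=` box c1 &
    box (c n) `&` ~` [set x | B (x j)] `<=` box c2].
  by move=> n; exact: box_split.
under eq_eseriesr => n _ do have [_ _ -> _ _] := c12 n.
rewrite nneseriesD; [|by move=> *; exact: vol_ge0..].
apply: leeD; apply: boxouter_le.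
- by move=> n; have [] := c12 n.
- by move=> x [/Xc[n _ cx] Bx]; exists n => //; have [_ _ _ + _] := c12 n; apply.
- by move=> n; have [] := c12 n.
- by move=> x [/Xc[n _ cx] Bx]; exists n => //; have [_ _ _ _ +] := c12 n; apply.
Qed.

End box.

(** * Countable subbases *)

(** Second countability, which makes the Borel sigma-algebra of a power coincide with the product
    sigma-algebra. *)
Definition countably_based (X : topologicalType) : Prop :=
  exists2 b : nat -> set X, (forall n, open (b n)) &
    forall x (O : set X), open O -> O x -> exists2 n, b n x & b n `<=` O.

Section subbase.
Context (X : ptopologicalType) (J : countType) (b : J -> set X).

Definition finint (s : seq J) : set X := [set y | forall j, j \in s -> b j y].

(** That this filter converges to [x] for every [x] expresses that [b] is fine enough for a subbase.
    In this form the condition can be checked by convergence in initial topologies. *)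
Definition finint_filter (x : X) : set_system X :=
  filter_from [set s | finint s x] finint.

Lemma finint_cat s t : finint (s ++ t) = finint s `&` finint t.
Proof.
apply/seteqP; split => [y st|y [ys yt] j]; last by rewrite mem_cat => /orP[/ys|/yt].
by split=> j js; apply: st; rewrite mem_cat js ?orbT.
Qed.

Lemma filter_finint x : Filter (finint_filter x).
Proof.
apply: filter_from_filter; first by exists [::].
move=> s t xs xt; exists (s ++ t); last by rewrite finint_cat.
by rewrite /= finint_cat.
Qed.

Hypothesis bx : forall x, finint_filter x --> x.

Let finintP x O : open O -> O x -> exists2 s, finint s x & finint s `<=` O.
Proof. by move=> oO Ox; apply: bx; exact: open_nbhs_nbhs. Qed.

(** There are countably many finite sequences in [J], so an open set is a countable union of finite
    intersections of subbasic sets. *)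
Lemma subbase_sigma O : open O -> <<s range b >> O.
Proof.
move=> oO.
have -> : O = \bigcup_(s : seq J) (if `[< finint s `<=` O >] then finint s else set0).
  apply/seteqP; split => [x /(finintP oO)[s xs sO]|x [s _]].
    by exists s => //; rewrite asboolT.
  by case: ifPn => // /asboolP; exact.
apply: (@countable_bigcupT_measurable _ (g_sigma_algebraType (range b))) => //.
move=> s; case: ifPn => // _.
elim: s => [|j s ih].
  by rewrite (_ : finint [::] = setT)//; apply/seteqP; split.
rewrite -cat1s finint_cat; apply: measurableI => //.
rewrite (_ : finint [:: j] = b j); first by apply: sub_sigma_algebra; exists j.
apply/seteqP; split => [y|y by_ k]; first by apply; rewrite mem_head.
by rewrite inE => /eqP ->.
Qed.

Lemma subbase_countably_based : (forall j, open (b j)) -> countably_based X.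
Proof.
move=> ob.
exists (fun n => if unpickle n is Some s then finint s else set0).
  move=> n; case: unpickle => [s|]; last exact: open0.
  elim: s => [|j s ih].
    by rewrite (_ : finint [::] = setT); [exact: openT|apply/seteqP; split].
  rewrite -cat1s finint_cat; apply: openI => //.
  rewrite (_ : finint [:: j] = b j)//.
  apply/seteqP; split => [y|y by_ k]; first by apply; rewrite mem_head.
  by rewrite inE => /eqP ->.
move=> x O oO /(finintP oO)[s xs sO].
by exists (pickle s); rewrite pickleK.
Qed.

End subbase.

Lemma cvg_initial (S : choiceType) (T : topologicalType) (f : S -> T)
    (F : set_system S) (s : S) : Filter F ->
  f @ F --> f s -> F --> (s : initial_topology f).
Proof.
move=> FF fF A; rewrite nbhsE => -[_ [[V oV <-] Vs] VA].
by apply: filterS VA _; apply: fF; exact: open_nbhs_nbhs.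
Qed.

Lemma continuous_ptws_coord (I : Type) (E : topologicalType) (i : I) :
  continuous (fun x : {ptws I -> E} => x i).
Proof.
move=> x V xV; have /cvg_sup/(_ i) H := @cvg_id {ptws I -> E} (nbhs x).
exact: (H _ (@initial_continuous _ _ (fun f : I -> E => f i) x V xV)).
Qed.

Lemma cvg_ptws (I : Type) (E : topologicalType) (F : set_system {ptws I -> E})
    (x : {ptws I -> E}) : Filter F ->
  (forall i, (fun y : {ptws I -> E} => y i) @ F --> x i) -> F --> x.
Proof. by move=> FF Fx; apply/cvg_sup => i; exact: cvg_initial. Qed.

Section pow.
Context (E : ptopologicalType) (k : enat).

Lemma continuous_coord (i : index k) : continuous (fun x : pow E k => x i).
Proof. exact: continuous_ptws_coord. Qed.

Definition cyl (G : set (set E)) : set (set (pow E k)) :=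
  [set [set x | B (x i)] | i in setT & B in G].

Hypothesis cbE : countably_based E.

Let pow_subbase : exists b : index k * nat -> set (pow E k),
  [/\ forall j, open (b j), range b `<=` cyl open & forall x, finint_filter b x --> x].
Proof.
have [b ob bE] := cbE.
exists (fun j => [set x | b j.2 (x j.1)]); split.
- move=> [i n]; have /continuousP := @continuous_coord i; apply; exact: ob.
- by move=> _ [[i n] _ <-]; exists i => //; exists (b n) => //; exact: ob.
- move=> x; have FF := filter_finint (fun j => [set x : pow E k | b j.2 (x j.1)]) x.
  apply: cvg_ptws => i V; rewrite nbhsE => -[W [oW Wx] WV].
  have [n bx bW] := bE _ _ oW Wx.
  exists [:: (i, n)].
    by move=> j; rewrite inE => /eqP ->.
  move=> y /(_ (i, n)); rewrite mem_head => /(_ isT) /= /bW; exact: WV.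
Qed.

Lemma countably_based_pow : countably_based (pow E k).
Proof. by have [b [ob _ bx]] := pow_subbase; exact: subbase_countably_based bx ob. Qed.

Lemma open_pow_sigma : open `<=` <<s cyl open >>.
Proof.
have [b [_ bcyl bx]] := pow_subbase => O oO.
apply: (smallest_sub _ _ (subbase_sigma bx oO)).
  exact: smallest_sigma_algebra.
by move=> U /bcyl; exact: sub_gen_smallest.
Qed.

End pow.

(** * Borel sets and product measures on powers *)

Lemma measure_probability d (T : measurableType d) (R : realType)
    (m : {measure set T -> \bar R}) : m setT = 1%E ->
  exists pi : probability T R, forall A, pi A = m A.
Proof.
move=> m1; have mE A : mnormalize m point A = m A.
  by rewrite /mnormalize m1 onee_eq0/= invr1 mule1.
by exists (mnormalize m point).
Qed.

Lemma prob_ofE (R : realType) (E : ptopologicalType) (m : set (borel E) -> \bar R) :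
  (exists pi : probability (borel E) R, forall A, measurable A -> pi A = m A) ->
  forall A, measurable A -> prob_of m A = m A.
Proof. by move=> /getPex; exact. Qed.

(** The representative is selected from the Borel values alone, so agreement on Borel sets yields an
    equality of probabilities, as the final statement demands. *)
Lemma prob_of_ext (R : realType) (E : ptopologicalType)
    (m1 m2 : set (borel E) -> \bar R) :
  (forall A, measurable A -> m1 A = m2 A) -> prob_of m1 = prob_of m2.
Proof.
move=> m12; rewrite /prob_of; congr get; apply/seteqP; split => pi piE A mA.
  by rewrite -m12// piE.
by rewrite m12// piE.
Qed.

Lemma prob_of_pushforward (R : realType) (E F : ptopologicalType)
    (P : probability (borel F) R) (f : borel F -> borel E) :
  measurable_fun setT f ->
  forall A, measurable A -> prob_of (pushforward P f) A = P (f @^-1` A).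
Proof.
move=> mf A mA; rewrite prob_ofE//.
have [|pi piE] := @measure_probability _ _ _ (giry_map mf P).
  by rewrite /= /pushforward preimage_setT probability_setT.
by exists pi.
Qed.

Lemma continuous_borel (E F : ptopologicalType) (f : E -> F) :
  continuous f -> measurable_fun setT (f : borel E -> borel F).
Proof.
move=> /continuousP cf; apply: (@measurability _ _ (borel E) (borel F) setT f (@open F)) => //.
move=> _ [U oU <-].
by rewrite setTI; apply: sub_sigma_algebra; exact: cf.
Qed.

Section pow_measurable.
Context (E : ptopologicalType) (k : enat).

Lemma measurable_coord (i : index k) :
  measurable_fun setT (fun x : borel (pow E k) => x i : borel E).
Proof. by apply: continuous_borel; exact: continuous_coord. Qed.

Definition rect (J : seq (index k)) (A : index k -> set E) : set (pow E k) :=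
  [set x | forall i, i \in J -> A i (x i)].

Lemma rect_cons i J A : rect (i :: J) A = [set x | A i (x i)] `&` rect J A.
Proof.
apply/seteqP; split => [x xA|x [xi xJ] j].
  by split => [|j jJ]; apply: xA; rewrite inE ?eqxx// jJ orbT.
by rewrite inE => /predU1P[->//|]; exact: xJ.
Qed.

Lemma rect_nil A : rect [::] A = setT.
Proof. by apply/seteqP; split. Qed.

Lemma measurable_rect J (A : index k -> set (borel E)) :
  (forall i, measurable (A i)) -> measurable (rect J A : set (borel (pow E k))).
Proof.
move=> mA; elim: J => [|i J ih]; first by rewrite rect_nil.
rewrite rect_cons; apply: measurableI => //.
by rewrite -[X in measurable X]setTI; exact: (@measurable_coord i measurableT _ (mA i)).
Qed.

Hypothesis cbE : countably_based E.

(** Second countability reduces open sets of the power to cylinders over open sets. *)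
Lemma borel_powE (G : set (set E)) :
  (measurable : set (set (borel E))) = <<s G >> ->
  (measurable : set (set (borel (pow E k)))) = <<s cyl G >>.
Proof.
move=> mG; apply/seteqP; split; last first.
  apply: smallest_sub => [|_ [i _ [B GB <-]]]; first exact: sigma_algebra_measurable.
  rewrite -[X in measurable X]setTI; apply: measurable_coord => //.
  by rewrite mG; exact: sub_sigma_algebra.
apply: smallest_sub; first exact: smallest_sigma_algebra.
apply: subset_trans (open_pow_sigma cbE) _.
apply: smallest_sub; first exact: smallest_sigma_algebra.
move=> _ [i _ [B oB <-]].
(* Coordinates are measurable for the sigma-algebra generated by [cyl G], since it suffices to test
   them on the generator [G]; cylinders over open sets therefore belong to it. *)
have mi : measurable_fun setT
    (fun x : g_sigma_algebraType (@cyl E k G) => x i : borel E).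
  apply: (@measurability _ _ _ (borel E) setT _ G) => // _ [U GU <-].
  by rewrite setTI; apply: sub_sigma_algebra; exists i => //; exists U.
have mB : measurable (B : set (borel E)) by exact: sub_sigma_algebra.
by have := mi measurableT _ mB; rewrite setTI.
Qed.

Lemma measurable_fun_pow d (X : measurableType d) (f : X -> pow E k) :
  (forall i, measurable_fun setT (fun x => f x i : borel E)) ->
  measurable_fun setT (f : X -> borel (pow E k)).
Proof.
move=> mf; apply: (@measurability _ _ X (borel (pow E k)) setT f
  (@cyl E k open)); first exact: borel_powE.
move=> _ [_ [i _ [B oB <-]] <-]; apply: mf => //; exact: sub_sigma_algebra.
Qed.

Definition rects (G : set (set E)) : set (set (pow E k)) :=
  [set X | exists J A, [/\ uniq J, forall i, G (A i) & X = rect J A]].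

Lemma setI_closed_rects G : setI_closed G -> G setT -> setI_closed (rects G).
Proof.
move=> GI GT _ _ [J [A [uJ GA ->]]] [J' [A' [uJ' GA' ->]]].
pose B (K : seq (index k)) (C : index k -> set E) i := if i \in K then C i else setT.
have GB K C i : (forall i, G (C i)) -> G (B K C i) by move=> GC; rewrite /B; case: ifP.
exists (undup (J ++ J')), (fun i => B J A i `&` B J' A' i); split.
- exact: undup_uniq.
- by move=> i; apply: GI; exact: GB.
- rewrite /rect /B; apply/seteqP; split => [x [xA xA'] i _|x xAA'].
    by split; case: ifP => // iJ; [exact: xA|exact: xA'].
  split=> i iJ; have := xAA' i; rewrite mem_undup mem_cat iJ ?orbT => /(_ isT).
    by case.
  by case.
Qed.

Lemma borel_pow_rects (G : set (set E)) :
  (measurable : set (set (borel E))) = <<s G >> ->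
  (measurable : set (set (borel (pow E k)))) = <<s rects G >>.
Proof.
move=> mG; apply/seteqP; split.
  rewrite (borel_powE mG); apply: smallest_sub; first exact: smallest_sigma_algebra.
  move=> _ [i _ [B GB <-]]; apply: sub_sigma_algebra.
  exists [:: i], (fun=> B); split => //.
  by rewrite rect_cons rect_nil setIT.
apply: smallest_sub => [|_ [J [A [_ GA ->]]]]; first exact: sigma_algebra_measurable.
by apply: measurable_rect => i; rewrite mG; exact: sub_sigma_algebra.
Qed.

(** Rectangles with sides in a generating pi-system form a generating pi-system. [G] is left general
    because [columns_iid] takes for it a family of rectangles. *)
Lemma pow_measure_unique (R : realType) (G : set (set E))
    (m1 m2 : {measure set (borel (pow E k)) -> \bar R}) :
  (measurable : set (set (borel E))) = <<s G >> -> setI_closed G -> G setT ->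
  (m1 setT < +oo)%E ->
  (forall J A, uniq J -> (forall i, G (A i)) -> m1 (rect J A) = m2 (rect J A)) ->
  forall B, measurable B -> m1 B = m2 B.
Proof.
move=> mG GI GT m1T m12 B mB.
have rT : rects G setT by exists [::], (fun=> setT); rewrite rect_nil.
apply: (@g_sigma_algebra_measure_unique _ R (borel (pow E k)) (rects G) _
  (fun=> setT)) => //.
- by rewrite (borel_pow_rects mG); exact: sub_sigma_algebra.
- by rewrite bigcup_const.
- exact: setI_closed_rects.
- by move=> _ [J [A [uJ GA ->]]]; exact: m12.
- by rewrite -(borel_pow_rects mG).
Qed.

Lemma measurableE_borel :
  (measurable : set (set (borel E))) = <<s (measurable : set (set (borel E))) >>.
Proof. by rewrite smallest_id//; exact: sigma_algebra_measurable. Qed.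

End pow_measurable.

(** * Existence, uniqueness and Fubini's theorem for product probabilities *)

Section product.
Context (R : realType) (E : ptopologicalType) (k : enat).
Hypothesis cbE : countably_based E.
Local Open Scope ereal_scope.

(** Borel sets are generated by one-coordinate cylinders, hence Carathéodory measurable, and the
    outer measure of boxes restricts to a measure on them. *)
Lemma product_ex (mu : index k -> probability (borel E) R) :
  exists P : probability (borel (pow E k)) R,
    forall (J : seq (index k)) (A : index k -> set (borel E)),
      uniq J -> (forall i, measurable (A i)) ->
      P (rect J A) = \prod_(i <- J) mu i (A i).
Proof.
have mcara B : (measurable : set (set (borel (pow E k)))) B ->
    (boxouter mu).-caratheodory B.
  rewrite (borel_powE k cbE (measurableE_borel E)); move: B.
  apply: smallest_sub; first exact: (@sigma_algebra_measurable _
    (caratheodory_type (boxouter mu))).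
  by move=> _ [i _ [B mB <-]]; exact: boxouter_caratheodory.
have m0 : boxouter mu (set0 : set (borel (pow E k))) = 0 by exact: outer_measure0.
have mge0 (B : set (borel (pow E k))) : 0 <= boxouter mu B.
  exact: outer_measure_ge0.
have madd : semi_sigma_additive (boxouter mu : set (borel (pow E k)) -> \bar R).
  move=> F mF tF mUF.
  apply: (@caratheodory_measure_sigma_additive _ _ (boxouter mu)) => //.
    by move=> n; exact: mcara.
  exact: mcara.
pose mM := isMeasure.Build _ _ _
  (boxouter mu : set (borel (pow E k)) -> \bar R) m0 mge0 madd.
pose m : {measure set (borel (pow E k)) -> \bar R} :=
  HB.pack (boxouter mu : set (borel (pow E k)) -> \bar R) mM.
have mE J (A : index k -> set (borel E)) : uniq J -> (forall i, measurable (A i)) ->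
    m (rect J A) = \prod_(i <- J) mu i (A i).
  by move=> uJ mA; exact: (@boxouter_box _ _ _ _ mu (Some (J, A))).
have [|P PE] := @measure_probability _ _ _ m.
  by rewrite -(rect_nil (fun=> setT)) mE// big_nil.
by exists P => J A uJ mA; rewrite PE mE.
Qed.

Lemma prod_probE (mu : index k -> probability (borel E) R) J
    (A : index k -> set (borel E)) : uniq J -> (forall i, measurable (A i)) ->
  prod_prob mu (rect J A) = \prod_(i <- J) mu i (A i).
Proof. by move=> uJ mA; have /getPex := product_ex mu; apply. Qed.

Lemma prod_prob_unique (mu : index k -> probability (borel E) R)
    (m : {measure set (borel (pow E k)) -> \bar R}) :
  (forall J (A : index k -> set (borel E)), uniq J -> (forall i, measurable (A i)) ->
    m (rect J A) = \prod_(i <- J) mu i (A i)) ->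
  forall B, measurable B -> m B = prod_prob mu B.
Proof.
move=> mE; apply: (pow_measure_unique cbE (measurableE_borel E)) => //.
- by move=> A B; exact: measurableI.
- by rewrite -(rect_nil (fun=> setT)) mE// big_nil ltry.
- by move=> J A uJ mA; rewrite mE//; exact/esym/prod_probE.
Qed.

(** Dynkin induction from rectangles, on which the value is a finite product of measurable
    functions. *)
Lemma measurable_prod_prob d (X : measurableType d)
    (K : index k -> X -> probability (borel E) R) :
  (forall i A, measurable A -> measurable_fun setT (fun x => K i x A)) ->
  forall B, measurable B ->
    measurable_fun setT (fun x => prod_prob (fun i => K i x) B).
Proof.
move=> mK B mB.
have mE := borel_pow_rects k cbE (measurableE_borel E).
have : <<s @rects E k (measurable : set (set (borel E))) >> B by rewrite -mE.
move: B {mB}; apply: (@dynkin_induction _ (borel (pow E k))) => //=.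
- by apply: setI_closed_rects => // A B; exact: measurableI.
- by under eq_fun do rewrite probability_setT; exact: measurable_cst.
- move=> _ [J [A [uJ mA ->]]].
  under eq_fun do rewrite prod_probE//.
  by apply: emeasurable_prod => i; exact: mK.
- move=> B mB ih; under eq_fun do rewrite probability_setC//.
  by apply: emeasurable_funB => //; exact: measurable_cst.
- move=> F mF tF ih.
  under eq_fun do rewrite (measure_semi_bigcup _ mF tF
    (bigcup_measurable (fun n _ => mF n))).
  by apply: ge0_emeasurable_sum => [n x _ _|n _] //; exact: ih.
Qed.

Lemma measurable_upd (i : index k) : measurable_fun setT
  (fun p : borel E * borel (pow E k) => upd (p.2 : index k -> E) i p.1 : borel (pow E k)).
Proof.
apply: measurable_fun_pow => // j; rewrite /upd.
case: (j == i); first exact: measurable_fst.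
by apply: (measurableT_comp (@measurable_coord _ _ j)); exact: measurable_snd.
Qed.

(* Resampling the coordinate [i] allows Fubini's theorem to separate it from the
   other ones. *)
Lemma prod_prob_upd (mu : index k -> probability (borel E) R) (i : index k)
    (B : set (borel (pow E k))) : measurable B ->
  (mu i \x prod_prob mu) [set p : borel E * borel (pow E k) |
    B (upd (p.2 : index k -> E) i p.1)] = prod_prob mu B.
Proof.
have mupd := measurable_upd i.
pose m := giry_map mupd (giry_prod (mu i : giry _ R, prod_prob mu : giry _ R)).
move=> mB; rewrite -(@prod_prob_unique mu m)// => J A uJ mA.
rewrite /m /= /pushforward.
have [iJ|iJ] := boolP (i \in J).
  rewrite [X in (_ \x _) X](_ : _ = A i `*` rect (rem i J) A); last first.
    apply/seteqP; split => [[y x] /= yxA|[y x] [/= Aiy xA] j /= jJ].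
      split => [|j]; first by have := yxA i iJ; rewrite /= upd_same.
      rewrite mem_rem_uniq// inE => /andP[ji jJ].
      by have := yxA j jJ; rewrite /= upd_other.
    have [->|ji] := eqVneq j i; first by rewrite upd_same.
    by rewrite upd_other//; apply: xA; rewrite mem_rem_uniq// inE ji.
  rewrite product_measure1E//; last exact: measurable_rect.
  by rewrite [RHS](big_rem i)//= prod_probE// rem_uniq.
rewrite [X in (_ \x _) X](_ : _ = [set: borel E] `*` rect J A); last first.
  apply/seteqP; split => [[y x] /= yxA|[y x] [/= _ xA] j /= jJ].
    split => // j jJ; have := yxA j jJ; rewrite /= upd_other//.
    by apply: contraNneq iJ => <-.
  rewrite upd_other; first exact: xA.
  by apply: contraNneq iJ => <-.
rewrite product_measure1E//; last exact: measurable_rect.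
transitivity (1 * prod_prob mu (rect J A)); last by rewrite mul1e prod_probE.
by congr (_ * _); exact: probability_setT.
Qed.

(** Once coordinate [i] is resampled independently, the remaining factors do not see it and the
    double integral splits. *)
Lemma integral_prod_prob (mu : index k -> probability (borel E) R)
    (f : index k -> borel E -> \bar R) (J : seq (index k)) : uniq J ->
  (forall i, measurable_fun setT (f i)) -> (forall i x, 0 <= f i x) ->
  \int[prod_prob mu]_x (\prod_(i <- J) f i (x i)) =
  \prod_(i <- J) \int[mu i]_y f i y.
Proof.
move=> uJ mf f0; elim: J uJ => [_|i J ih /= /andP[iJ uJ]].
  under eq_integral do rewrite big_nil.
  by rewrite big_nil integral_cst//= probability_setT mul1e.
have mfx j : measurable_fun setT (fun x : borel (pow E k) => f j (x j)).
  exact: measurableT_comp (mf j) (@measurable_coord _ _ j).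
have f0x (K : seq (index k)) (x : pow E k) : 0 <= \prod_(j <- K) f j (x j).
  exact: prode_ge0.
have mupd := measurable_upd i.
transitivity (\int[giry_map mupd (giry_prod (mu i : giry _ R, prod_prob mu : giry _ R))]_x
    (\prod_(j <- i :: J) f j (x j))).
  apply: eq_measure_integral => B mB _; apply/esym; exact: prod_prob_upd.
rewrite [LHS]giry_int_map//; last exact: emeasurable_prod.
rewrite [LHS]giry_int_prod1//=; last first.
  by apply: measurableT_comp => //; exact: emeasurable_prod.
rewrite /giry_int.
under eq_integral => y _.
  under eq_integral => x _.
    rewrite big_cons upd_same big_seq (eq_bigr (fun j => f j (x j))); last first.
      by move=> j jJ; rewrite upd_other//; apply: contraNneq iJ => <-.
    rewrite -big_seq; over.
  rewrite ge0_integralZl//; last exact: emeasurable_prod.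
  rewrite ih// muleC.
  over.
rewrite ge0_integralZl//; last first.
  by apply: prode_ge0 => j _; apply: integral_ge0 => y _; exact: f0.
by rewrite big_cons muleC.
Qed.

End product.

(** * Lower semicontinuous functions on a Polish space *)

Lemma separable_seq (E : ptopologicalType) : separable E ->
  exists e : nat -> E, forall W : set E, open W -> W !=set0 -> exists n, W (e n).
Proof.
move=> [D /countable_injP[phi phi_inj] dD].
(* At an [n] that [phi] does not reach on [D] the value is arbitrary, which does no harm. *)
exists (fun n => get [set x | D x /\ phi x = n]) => W oW W0.
have [x [Wx Dx]] := dD W W0 oW.
exists (phi x); have [Dy /phi_inj] : [set y | D y /\ phi y = phi x]
    (get [set y | D y /\ phi y = phi x]) by apply: getPex; exists x.
by rewrite !inE => ->.
Qed.

(** The last clause says that each nonnegative lower semicontinuous function is the supremum of the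
    members of the countable family below it; openness of all sets [a < G x] is lower semicontinuity
    of [G]. *)
Definition lsc_base (R : realType) (E : ptopologicalType) (J : countType)
    (c : J -> E -> R) : Prop :=
  [/\ forall j, continuous (c j), forall j x, 0 <= c j x,
      forall j, exists M, forall x, c j x <= M &
      forall G : E -> R, (forall x, 0 <= G x) ->
        (forall a, open [set x | a < G x]) ->
        forall x a, a < G x -> exists2 j, (forall y, c j y <= G y) & a < c j x].

Lemma lsc_base_polish (R : realType) (E : ptopologicalType) : polish R E ->
  exists (J : countType) (c : J -> E -> R), lsc_base c.
Proof.
move=> [/separable_seq[e eD] [M [f [g [fK gK cf cg _]]]]].
pose dist x y := mdist (f x) (f y).
pose c (j : nat * rat * nat) x : R :=
  Num.max 0 (ratr j.1.2 - j.2%:R * dist x (e j.1.1)).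
have dist_cvg x d : 0 < d -> \forall y \near x, dist x y < d.
  move=> d0; have : nbhs x (f @^-1` ball (f x) d) by apply: cf; exact: nbhsx_ballx.
  by apply: filterS => y; rewrite /= ballEmdist.
exists (nat * rat * nat)%type, c; split.
- move=> [[n p] q] x; rewrite /c /=.
  apply: (@continuous_max R E (cst 0) (fun x => ratr p - q%:R * dist x (e n)) x).
    exact: cvg_cst.
  apply: (@cvgB _ R^o); first exact: cvg_cst.
  apply: (@cvgM R); first exact: cvg_cst.
  apply/(@cvgrPdist_lt _ R^o) => d d0; apply: filterS (dist_cvg x d d0) => y xy.
  apply: le_lt_trans xy; rewrite ler_norml /dist.
  have := metric_triangle (f x) (f y) (f (e n)).
  have := metric_triangle (f y) (f x) (f (e n)).
  rewrite (metric_sym (f y) (f x)); lra.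
- by move=> j x; rewrite /c le_max lexx.
- move=> [[n p] q]; exists (Num.max 0 (ratr p)) => x; rewrite /c /=.
  rewrite ge_max !le_max lexx /=; apply/orP; right.
  by rewrite gerBl mulr_ge0// /dist mdist_ge0.
- move=> G G0 oG x a aG.
  have [a0|a0] := ltP a 0.
    (* With [p = q = 0] the function vanishes identically. *)
    exists (0%N, 0%Q, 0%N) => [y|]; rewrite /c /= raddf0 mul0r subr0 maxxx//.
  have [p] := rat_in_itvoo aG; rewrite in_itv /= => /andP[ap pG].
  have p0 : 0 < ratr p :> R := le_lt_trans a0 ap.
  have : nbhs (f x) (g @^-1` [set y | ratr p < G y]).
    by apply: cg; rewrite fK; apply: open_nbhs_nbhs; split.
  rewrite -nbhs_ballE => -[d /= d0 dG].
  have {}dG y : dist x y < d -> ratr p < G y.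
    by move=> xy; have := dG (f y); rewrite ballEmdist /= fK; apply.
  (* This slope makes the function vanish at distance at least [d / 2] from its centre. With a
     centre within [d / 2] of [x], it is positive only where [G] exceeds its peak [p]. *)
  have [q pq] : exists q : nat, ratr p < q%:R * (d / 2).
    exists (Num.bound (ratr p / (d / 2))).
    by rewrite -ltr_pdivrMr ?divr_gt0// archi_boundP// ltW// divr_gt0// divr_gt0.
  have q0 : 0 < q%:R :> R.
    by rewrite lt0r ler0n andbT; apply/eqP => q0; move: pq; rewrite q0; lra.
  (* Every centre in [A] is close enough to [x] for the function to exceed [a] at [x]; density
     supplies one from the sequence [e]. *)
  pose A := [set z | dist x z < d / 2 /\ q%:R * dist x z < ratr p - a].
  have xA : nbhs x A.
    have pa0 : 0 < (ratr p - a) / q%:R by rewrite divr_gt0// subr_gt0.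
    have d20 : 0 < d / 2 by rewrite divr_gt0.
    apply: filterS (filterI (dist_cvg x _ d20) (dist_cvg x _ pa0)) => z [z1 z2].
    by split => //; rewrite mulrC -ltr_pdivlMr.
  have [|n /interior_subset[xn1 xn2]] := eD A^° (open_interior A); first by exists x.
  exists (n, p, q) => [y|]; rewrite /c /=; last by rewrite lt_max; apply/orP; right; lra.
  rewrite ge_max G0 /=; have [yn|yn] := ltP (q%:R * dist y (e n)) (ratr p); last first.
    by rewrite (le_trans _ (G0 y))// subr_le0.
  have xy : dist x y < d.
    have : dist y (e n) < d / 2.
      by rewrite -(ltr_pM2l q0); exact: lt_trans pq.
    have := metric_triangle (f x) (f (e n)) (f y).
    rewrite (metric_sym (f (e n)) (f y)); move: xn1; rewrite /dist; lra.
  have := dG _ xy; have : 0 <= q%:R * dist y (e n) by rewrite mulr_ge0// mdist_ge0.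
  lra.
Qed.

Lemma open_lt_indic (R : realType) (E : topologicalType) (W : set E) (a : R) :
  open W -> open [set x | a < \1_W x].
Proof.
move=> oW; have [a0|a0] := ltP a 0.
  rewrite (_ : [set _ | _] = setT); first exact: openT.
  by apply/seteqP; split => y //= _; rewrite (lt_le_trans a0)// indicE.
have [a1|a1] := ltP a 1.
  rewrite (_ : [set _ | _] = W)//; apply/seteqP; split => y /=; rewrite indicE.
    by have [/set_mem//|] := boolP (y \in W); rewrite ltNge a0.
  by move=> Wy; rewrite mem_set.
rewrite (_ : [set _ | _] = set0); first exact: open0.
apply/seteqP; split => y //=; rewrite indicE ltNge (le_trans _ a1)//.
by case: (_ \in _); rewrite /= ?ler01.
Qed.

Section lsc_base_theory.
Context (R : realType) (E : ptopologicalType) (J : countType) (c : J -> E -> R).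
Hypothesis cE : lsc_base c.

Definition hmax (l : seq J) (x : E) : R := \big[Num.max/0]_(j <- l) c j x.

Lemma hmax_ge0 l x : 0 <= hmax l x.
Proof.
rewrite /hmax; elim: l => [|j l ih]; first by rewrite big_nil.
by rewrite big_cons le_max ih orbT.
Qed.

Lemma hmax_le l x M : 0 <= M -> (forall j, j \in l -> c j x <= M) -> hmax l x <= M.
Proof.
move=> M0; rewrite /hmax; elim: l => [|j l ih] cM; first by rewrite big_nil.
rewrite big_cons ge_max cM ?mem_head//= ih// => i il.
by apply: cM; rewrite inE il orbT.
Qed.

Lemma hmax_ge l x j : j \in l -> c j x <= hmax l x.
Proof.
rewrite /hmax; elim: l => // i l ih; rewrite inE big_cons le_max.
by case/predU1P => [->|/ih ->]; rewrite ?lexx ?orbT.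
Qed.

Lemma continuous_hmax l : continuous (hmax l).
Proof.
have [cc _ _ _] := cE; elim: l => [|j l ih] x.
  have -> : hmax [::] = cst 0 by apply/funext => y; rewrite /hmax big_nil.
  exact: cvg_cst.
have -> : hmax (j :: l) = c j \max hmax l by apply/funext => y; rewrite /hmax big_cons.
by apply: (@continuous_max R E (c j) (hmax l) x); [exact: cc|exact: ih].
Qed.

Lemma hmax_bounded l : exists M, forall x, `|hmax l x| <= M.
Proof.
have [_ c0 cM _] := cE; suff [M M0 lM] : exists2 M, 0 <= M & forall x, hmax l x <= M.
  by exists M => x; rewrite ger0_norm// hmax_ge0.
elim: l => [|j l [M M0 lM]]; first by exists 0 => // x; rewrite /hmax big_nil.
have [N jN] := cM j.
exists (Num.max N M); first by rewrite le_max M0 orbT.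
by move=> x; rewrite /hmax big_cons ge_max !le_max jN lM orbT.
Qed.

Definition hfun l : cbfun R E :=
  exist _ (hmax l) (conj (@continuous_hmax l) (hmax_bounded l)).

(** Maxima over the members below [G] of code less than [n] turn the supremum into a monotone limit,
    ready for monotone convergence. *)
Lemma lsc_approx (G : E -> R) : (forall x, 0 <= G x) ->
  (forall a, open [set x | a < G x]) ->
  exists l : nat -> seq J, [/\ forall n x, hmax (l n) x <= G x,
    forall x, nondecreasing_seq (fun n => hmax (l n) x) &
    forall x, hmax (l n) x @[n --> \oo] --> G x].
Proof.
move=> G0 oG; have [_ _ _ cG] := cE.
pose l n := [seq j <- pmap (@pickle_inv J) (iota 0 n) | `[< forall y, c j y <= G y >]].
have mem_l j n : (j \in l n) = `[< forall y, c j y <= G y >] && (pickle j < n)%N.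
  rewrite mem_filter mem_pmap; congr (_ && _); apply/mapP/idP => [[m]|jn].
    rewrite mem_iota /= => mn /esym mj.
    by have := @pickle_invK J m; rewrite mj /= => ->.
  by exists (pickle j); rewrite ?mem_iota// pickleK_inv.
exists l; split.
- move=> n x; apply: hmax_le => // j; rewrite mem_l => /andP[/asboolP]; by [].
- move=> x m n mn; apply: hmax_le; first exact: hmax_ge0.
  move=> j; rewrite mem_l => /andP[jG jm]; apply: hmax_ge.
  by rewrite mem_l jG (leq_trans jm).
- move=> x; apply/cvgrPdist_lt => e e0.
  have [|j jG jx] := cG G G0 oG x (G x - e); first by rewrite ltrBlDr ltrDl.
  exists (pickle j).+1 => // n /= jn.
  have xG : hmax (l n) x <= G x.
    by apply: hmax_le => // i; rewrite mem_l => /andP[/asboolP].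
  rewrite ger0_norm ?subr_ge0// ltrBlDr -ltrBlDl (lt_le_trans jx)//.
  by apply: hmax_ge; rewrite mem_l jn andbT; exact/asboolP.
Qed.

(** The positivity sets of the [c j] form a base: a member below the indicator of an open set [W] is
    positive only inside [W]. *)
Lemma lsc_base_countably_based : countably_based E.
Proof.
have [cc _ _ cG] := cE.
have oc (j : J) : open [set x | 0 < c j x].
  by have /continuousP/(_ [set y | 0 < y]) := cc j; apply; exact: open_gt.
exists (fun n => if unpickle n is Some j then [set x | 0 < c j x] else set0).
  by move=> n; case: unpickle => [j|]; [exact: oc|exact: open0].
move=> x W oW Wx.
have [|||j jW j0] := cG (\1_W) _ _ x 0.
- by move=> y; rewrite indicE.
- by move=> a; exact: open_lt_indic.
- by rewrite indicE mem_set.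
exists (pickle j); rewrite pickleK// => y /= jy.
have := lt_le_trans jy (jW y); rewrite indicE.
by have [/set_mem//|] := boolP (y \in W); rewrite ltxx.
Qed.

End lsc_base_theory.

(** * The weak topology *)

Lemma continuous_borel_real (R : realType) (E : ptopologicalType) (f : E -> R) :
  continuous f -> measurable_fun setT (f : borel E -> R).
Proof.
move=> /continuousP cf.
apply: (measurability _ (RGenOInfty.measurableE R)) => _ [_ [a ->] <-].
rewrite setTI; apply: sub_sigma_algebra; apply: cf; exact: interval_open.
Qed.

Section weak.
Context (R : realType) (E : ptopologicalType).
Implicit Types (mu nu : Prob R E) (phi : cbfun R E).

Lemma cbfun_integrable mu phi :
  (mu : probability (borel E) R).-integrable setT (EFin \o sval phi).
Proof.
case: phi => f [cf [M fM]] /=; apply: measurable_bounded_integrable => //.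
- by rewrite (@le_lt_trans _ _ 1%E) ?ltry// probability_le1.
- exact: continuous_borel_real.
- exists M; split; first exact: num_real.
  by move=> N MN x _ /=; exact: le_trans (fM x) (ltW MN).
Qed.

Lemma cbintE mu phi :
  (cbint mu phi)%:E = (\int[mu : probability (borel E) R]_x (sval phi x)%:E)%E.
Proof.
rewrite /cbint /Rintegral fineK//.
by apply: integrable_fin_num => //; exact: cbfun_integrable.
Qed.

Lemma continuous_cbint phi : continuous (fun mu => cbint mu phi).
Proof.
move=> mu; apply: (@continuous_comp (Prob R E) {ptws cbfun R E -> R} R (@cbint R E)
  (fun y => y phi)).
  exact: initial_continuous.
exact: continuous_ptws_coord.
Qed.

Lemma measurable_cbint phi :
  measurable_fun setT (fun mu : borel (Prob R E) => cbint mu phi).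
Proof. exact: (@continuous_borel_real R (Prob R E) _ (@continuous_cbint phi)). Qed.

Context (J : countType) (c : J -> E -> R).
Hypothesis cE : lsc_base c.

Lemma cvg_cbint_hfun (G : E -> R) (l : nat -> seq J) mu :
  (forall x, nondecreasing_seq (fun n => hmax c (l n) x)) ->
  (forall x, hmax c (l n) x @[n --> \oo] --> G x) ->
  (cbint mu (hfun cE (l n)))%:E @[n --> \oo] -->
    (\int[mu : probability (borel E) R]_x (G x)%:E)%E.
Proof.
move=> nd_l l_G.
under eq_fun do rewrite cbintE.
have -> : (\int[mu : probability (borel E) R]_x (G x)%:E =
    \int[mu : probability (borel E) R]_x limn (fun n => (hmax c (l n) x)%:E))%E.
  apply: eq_integral => x _; apply/esym/cvg_lim => //.
  by apply/cvg_EFin; [exact: nearW|exact: l_G].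
apply: cvg_monotone_convergence => //.
- move=> n; apply/measurable_EFinP; apply: continuous_borel_real.
  exact: continuous_hmax.
- by move=> n x _; rewrite lee_fin hmax_ge0.
- by move=> x _ m n mn; rewrite lee_fin; exact: nd_l.
Qed.

(** The indicator of an open set is an increasing limit of bounded continuous functions, whose
    integrals depend measurably on [mu]; Dynkin induction does the rest. *)
Lemma measurable_prob_eval (A : set (borel E)) : measurable A ->
  measurable_fun setT (fun mu : borel (Prob R E) => (mu : probability (borel E) R) A).
Proof.
move: A; apply: (@dynkin_induction _ (borel E) open) => //.
- exact: openI.
- by under eq_fun do rewrite probability_setT; exact: measurable_cst.
- move=> U oU.
  have [||l [lU nd_l l_cvg]] := lsc_approx cE (G := \1_U).
  + by move=> x; rewrite indicE.
  + by move=> a; exact: open_lt_indic.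
  apply: (emeasurable_fun_cvg (fun n (mu : borel (Prob R E)) =>
    (cbint mu (hfun cE (l n)))%:E)).
    by move=> n; apply/measurable_EFinP; exact: measurable_cbint.
  move=> mu _; have mU : measurable (U : set (borel E)) by exact: sub_sigma_algebra.
  rewrite [X in _ --> X](_ : _ =
    (\int[mu : probability (borel E) R]_x (\1_U x)%:E)%E); last first.
    by rewrite integral_indic// setIT.
  exact: cvg_cbint_hfun.
- move=> B mB ih; under eq_fun do rewrite probability_setC//.
  by apply: emeasurable_funB => //; exact: measurable_cst.
- move=> F mF tF ih.
  under eq_fun do rewrite (measure_semi_bigcup _ mF tF
    (bigcup_measurable (fun n _ => mF n))).
  by apply: ge0_emeasurable_sum => [n x _ _|n _] //; exact: ih.
Qed.

Definition weak_subbase (j : seq J * rat) : set (Prob R E) :=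
  [set mu | ratr j.2 < cbint mu (hfun cE j.1)].

(** By monotone convergence some [hmax] below [phi] has an integral within [e] of that of [phi]; a
    rational threshold in the gap gives the subbasic set. *)
Lemma weak_lower phi mu e : (forall x, 0 <= sval phi x) -> 0 < e ->
  exists2 j, weak_subbase j mu &
    forall nu, weak_subbase j nu -> cbint mu phi - e < cbint nu phi.
Proof.
move=> phi0 e0.
have [|l [l_phi nd_l l_cvg]] := lsc_approx cE phi0.
  move=> a; case: phi {phi0} => f [/continuousP cf _] /=.
  by apply: (cf [set y | a < y]); exact: open_gt.
have := cvg_cbint_hfun nd_l l_cvg (mu := mu); rewrite -cbintE => /fine_cvg /=.
move=> /cvgrPdist_lt/(_ _ e0)[n _ /(_ n (leqnn n)) /=] ln.
have [|q] := @rat_in_itvoo R (cbint mu phi - e) (cbint mu (hfun cE (l n))).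
  by move: ln; rewrite ltr_norml; lra.
rewrite in_itv /= => /andP[q1 q2]; exists (l n, q) => // nu qnu.
apply: (lt_trans q1); apply: (lt_le_trans qnu).
rewrite -lee_fin !cbintE; apply: ge0_le_integral => //.
- by move=> x _; rewrite lee_fin hmax_ge0.
- by apply/measurable_EFinP; apply: continuous_borel_real; exact: continuous_hmax.
- apply/measurable_EFinP; apply: continuous_borel_real.
  by case: phi {phi0 l_phi l_cvg ln q1} => f [].
- by move=> x _; rewrite lee_fin; exact: l_phi.
Qed.

Lemma cbint_affine phi (M s : R) (psi : cbfun R E) mu :
  (forall x, sval psi x = M + s * sval phi x) ->
  cbint mu psi = M + s * cbint mu phi.
Proof.
move=> psiE; rewrite /cbint.
under eq_Rintegral do rewrite psiE.
have iphi := cbfun_integrable mu phi.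
rewrite RintegralD//; last 2 first.
- by apply: finite_measure_integrable_cst.
- exact: (integrableZl measurableT s iphi).
by rewrite RintegralZl// Rintegral_cst//= probability_setT mulr1.
Qed.

(** If [M] bounds the absolute value of [phi], then [M + phi] and [M - phi] are nonnegative, and
    lower bounds on their integrals bound that of [phi] from both sides. *)
Lemma weak_subbase_cvg (mu : Prob R E) : finint_filter weak_subbase mu --> mu.
Proof.
have FF := filter_finint weak_subbase mu.
apply: cvg_initial; apply: cvg_ptws => phi; apply/cvgrPdist_lt => e e0.
have [cphi [M phiM]] := svalP phi.
have affineP s : continuous (fun x => M + s * sval phi x) /\
    exists N : R, forall x, `|M + s * sval phi x| <= N.
  split.
    move=> x; apply: (@cvgD _ R^o); first exact: cvg_cst.
    by apply: (@cvgM R); [exact: cvg_cst|exact: cphi].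
  exists (`|M| + `|s| * M) => x; rewrite (le_trans (ler_normD _ _))// lerD2l.
  by rewrite normrM ler_wpM2l.
pose psi s : cbfun R E := exist _ _ (affineP s).
have [|j1 muj1 j1P] := @weak_lower (psi 1) mu e _ e0.
  by move=> x /=; have := phiM x; rewrite ler_norml; lra.
have [|j2 muj2 j2P] := @weak_lower (psi (-1)) mu e _ e0.
  by move=> x /=; have := phiM x; rewrite ler_norml; lra.
exists [:: j1; j2] => [j|nu nuj] /=.
  by rewrite !inE => /orP[|] /eqP ->.
have := j1P nu (nuj _ (mem_head _ _)).
have := j2P nu (nuj j2 _); rewrite !inE eqxx orbT => /(_ isT).
have psiE s nu' : cbint nu' (psi s) = M + s * cbint nu' phi.
  exact: cbint_affine.
rewrite !psiE ltr_norml; lra.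
Qed.

Lemma countably_based_prob : countably_based (Prob R E).
Proof.
apply: (subbase_countably_based weak_subbase_cvg) => j.
have /continuousP/(_ [set y | ratr j.2 < y]) := @continuous_cbint (hfun cE j.1).
by apply; exact: open_gt.
Qed.

(** Together with [measurable_prob_eval], this identifies the Borel sets of [Prob R E] with those
    generated by evaluations. Only the countable subbase is tested, through integrals against the
    kernel [K]. *)
Lemma measurable_fun_prob d (X : measurableType d) (K : X -> Prob R E) :
  (forall A, measurable A ->
    measurable_fun setT (fun x => (K x : probability (borel E) R) A)) ->
  measurable_fun setT (K : X -> borel (Prob R E)).
Proof.
move=> mK.
apply: (@measurability _ _ X (borel (Prob R E)) setT K (range weak_subbase)).
  apply/seteqP; split.
    apply: smallest_sub; first exact: smallest_sigma_algebra.
    exact: subbase_sigma weak_subbase_cvg.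
  apply: smallest_sub => [|_ [j _ <-]]; first exact: sigma_algebra_measurable.
  apply: sub_sigma_algebra.
  have /continuousP/(_ [set y | ratr j.2 < y]) := @continuous_cbint (hfun cE j.1).
  by apply; exact: open_gt.
move=> _ [_ [[l q] _ <-] <-]; rewrite setTI.
have mint : measurable_fun setT
    (fun x => \int[K x : probability (borel E) R]_y (hmax c l y)%:E)%E.
  apply: measurable_fun_integral_kernel => //.
    by move=> y; rewrite lee_fin hmax_ge0.
  by apply/measurable_EFinP; apply: continuous_borel_real; exact: continuous_hmax.
rewrite (_ : _ @^-1` _ = [set x | (ratr q)%:E <
  \int[K x : probability (borel E) R]_y (hmax c l y)%:E]%E); last first.
  by apply/seteqP; split => x /=; rewrite /weak_subbase /= -lte_fin cbintE.
rewrite -[X in measurable X]setTI; exact: emeasurable_fun_o_infty.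
Qed.

End weak.

(** * Moment measures *)

Lemma giry_bindE d1 d2 (T1 : measurableType d1) (T2 : measurableType d2)
    (R : realType) (m : giry T1 R) (f : T1 -> giry T2 R)
    (mf : measurable_fun setT f) (A : set T2) : measurable A ->
  giry_bind m mf A = (\int[m]_x f x A)%E.
Proof.
move=> mA; rewrite /giry_bind /=.
rewrite [LHS]giry_int_map//; exact: measurable_giry_ev.
Qed.

(** The value is the mass of [C] under the product of the Dirac measure at [f x] with [K x], and
    that product depends measurably on [x]. *)
Lemma measurable_giry_section d1 d2 d3 (X : measurableType d1)
    (Y : measurableType d2) (Z : measurableType d3) (R : realType)
    (f : X -> Y) (K : X -> giry Z R) (C : set (Y * Z)) :
  measurable_fun setT f -> measurable_fun setT K -> measurable C ->
  measurable_fun setT (fun x => K x [set z | C (f x, z)]).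
Proof.
move=> mf mK mC.
have -> : (fun x => K x [set z | C (f x, z)]) =
    (fun m => giry_ev m C) \o (@giry_prod _ _ Y Z R) \o
    (fun x => (giry_ret (f x), K x)).
  apply/funext => x /=; rewrite /giry_ev /giry_prod /= /product_measure1.
  rewrite integral_dirac ?diracT ?mul1e//=; last exact: measurable_fun_xsection.
  by congr (K x _); apply/seteqP; split => z; rewrite /xsection /= inE.
apply: measurableT_comp; first apply: measurableT_comp.
- exact: measurable_giry_ev.
- exact: measurable_giry_prod.
- apply/measurable_fun_pairP; split; last exact: mK.
  by apply: measurableT_comp mf; exact: measurable_giry_ret.
Qed.

Section mixture.
Context (R : realType) (W E : ptopologicalType) (r : probability (borel W) R).
Variable K : W -> probability (borel E) R.
Hypothesis mK : forall A, measurable A ->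
  measurable_fun setT (fun w : borel W => K w A).
Local Open Scope ereal_scope.

Let mK' : measurable_fun setT (fun w : borel W => K w : giry (borel E) R).
Proof. by apply: measurable_giry_codensity. Qed.

(** The bind of the Giry monad is a probability with the prescribed values, so [prob_of] is
    meaningful here. *)
Lemma mixtureE A : measurable A -> mixture r K A = \int[r]_w K w A.
Proof.
have [|pi piE] := @measure_probability _ _ _ (giry_bind r mK').
  rewrite [LHS]giry_bindE//; rewrite (eq_integral (cst 1)).
    by rewrite integral_cst//= mul1e; exact: probability_setT.
  by move=> w _; exact: probability_setT.
apply: prob_ofE; exists pi => B mB; rewrite piE; exact: giry_bindE.
Qed.

Lemma integral_mixture (f : borel E -> \bar R) : measurable_fun setT f ->
  (forall x, 0 <= f x) ->
  \int[mixture r K]_x f x = \int[r]_w \int[K w]_x f x.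
Proof.
move=> mf f0.
have := giry_int_bind r mK' mf f0; rewrite /giry_int => <-.
apply: eq_measure_integral => A mA _.
transitivity (\int[r]_w K w A); first exact: mixtureE.
by apply/esym; exact: giry_bindE.
Qed.

End mixture.

(** * Rows and columns of independent arrays *)

Section columns.
Context (R : realType) (S : ptopologicalType) (n k : enat).
Hypothesis cbS : countably_based S.
Local Open Scope ereal_scope.

Definition transpose (x : pow (pow S n) k) : pow (pow S k) n :=
  fun j i => x i j.

Lemma measurable_transpose : measurable_fun setT
  (transpose : borel (pow (pow S n) k) -> borel (pow (pow S k) n)).
Proof.
apply: (@measurable_fun_pow (pow S k) n (countably_based_pow k cbS)) => j.
apply: (@measurable_fun_pow S k cbS) => i.
exact: (measurableT_comp (@measurable_coord S n j)
  (@measurable_coord (pow S n) k i)).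
Qed.

(** Padding with full sides brings finitely many rectangles to one common list, so that the
    transposed set is again a rectangle of rectangles. *)
Let rects_unif (J : seq (index n)) (A : index n -> set (pow S k)) :
  (forall j, @rects S k (measurable : set (set (borel S))) (A j)) ->
  exists (K : seq (index k)) (C : index n -> index k -> set (borel S)),
    [/\ uniq K, forall j i, measurable (C j i) & forall j, j \in J -> A j = rect K (C j)].
Proof.
move=> /choice[I /choice[C AE]].
exists (undup (flatten (map I J))), (fun j i => if i \in I j then C j i else setT).
split; first exact: undup_uniq.
  by move=> j i; case: ifP => // _; have [_ + _] := AE j; exact.
move=> j jJ; have [_ _ ->] := AE j.
apply/seteqP; split => x xC i iI; first by case: ifP => // /xC.
have := xC i; rewrite iI mem_undup => /(_ _); apply.
by apply/flattenP; exists (I j) => //; exact: map_f.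
Qed.

(** On a rectangle of rectangles both sides are the same finite double product, taken in the two
    orders. *)
Lemma columns_iid (mu : index k -> probability (borel S) R)
    (B : set (borel (pow (pow S k) n))) : measurable B ->
  prod_prob (fun i => iid n (mu i)) (transpose @^-1` B) = iid n (prod_prob mu) B.
Proof.
have cbSn : countably_based (pow S n) by exact: countably_based_pow.
have cbSk : countably_based (pow S k) by exact: countably_based_pow.
have GI : setI_closed (@rects S k (measurable : set (set (borel S)))).
  by apply: setI_closed_rects => // X Y; exact: measurableI.
move: B; apply: (@pow_measure_unique _ n cbSk R _
    (giry_map measurable_transpose (prod_prob (fun i => iid n (mu i)) : giry _ R))
    (iid n (prod_prob mu)) (borel_pow_rects k cbS (measurableE_borel S)) GI).
- by exists [::], (fun=> setT); rewrite rect_nil.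
- rewrite /= /pushforward preimage_setT.
  by apply: le_lt_trans (ltry 1); exact: sprobability_setT.
move=> J A uJ /(rects_unif J)[K [C [uK mC AE]]].
have -> : rect J A = rect J (fun j => rect K (C j)).
  by apply/seteqP; split => x xA j jJ; have := xA j jJ; rewrite AE.
transitivity (\prod_(i <- K) \prod_(j <- J) mu i (C j i)).
  rewrite /= /pushforward.
  have -> : transpose @^-1` rect J (fun j => rect K (C j)) =
      rect K (fun i => rect J (fun j => C j i)).
    by apply/seteqP; split => x xC i iK j jJ; exact: xC.
  transitivity (\prod_(i <- K) iid n (mu i) (rect J (fun j => C j i))).
    by apply: prod_probE => // i; exact: measurable_rect.
  by apply: eq_bigr => i _; exact: prod_probE.
rewrite exchange_big; apply/esym.
transitivity (\prod_(j <- J) prod_prob mu (rect K (C j))).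
  by apply: prod_probE => // j; exact: measurable_rect.
by apply: eq_bigr => j _; exact: prod_probE.
Qed.

Context (g : pow S k -> S).
Hypothesis mg : measurable_fun setT (g : borel (pow S k) -> borel S).

Lemma higherE (mu : pow (Prob R S) k) A : measurable A ->
  (higher g mu : probability (borel S) R) A = prod_prob mu (g @^-1` A).
Proof. by move=> mA; exact: (prob_of_pushforward _ mg). Qed.

Let gmap (y : pow (pow S k) n) : pow S n := fun j => g (y j).

Let measurable_gmap :
  measurable_fun setT (gmap : borel (pow (pow S k) n) -> borel (pow S n)).
Proof.
apply: (@measurable_fun_pow S n cbS) => j.
exact: (measurableT_comp mg (@measurable_coord (pow S k) n j)).
Qed.

Lemma measurable_nvariate : measurable_fun setT
  (nvariate g : borel (pow (pow S n) k) -> borel (pow S n)).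
Proof. exact: (measurableT_comp measurable_gmap measurable_transpose). Qed.

(** [nvariate g] transposes and then applies [g] to each column. Columns are i.i.d. of law
    [prod_prob mu], so their images are i.i.d. of law [higher g mu]. *)
Lemma iid_higher (mu : pow (Prob R S) k) (A : set (borel (pow S n))) : measurable A ->
  iid n (higher g mu : probability (borel S) R) A =
  prod_prob (fun i => iid n (mu i : probability (borel S) R)) (nvariate g @^-1` A).
Proof.
move=> mA; rewrite (_ : nvariate g @^-1` A = transpose @^-1` (gmap @^-1` A))//.
rewrite columns_iid; last by rewrite -[X in measurable X]setTI; exact: measurable_gmap.
apply/esym; move: A mA.
apply: (@prod_prob_unique _ _ _ cbS (fun=> higher g mu : probability (borel S) R)
  (giry_map measurable_gmap (iid n (prod_prob mu) : giry _ R))) => J A uJ mA.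
rewrite /= /pushforward.
transitivity (\prod_(j <- J) prod_prob mu (g @^-1` A j)).
  apply: (prod_probE (countably_based_pow k cbS) (fun=> prod_prob mu)) => // j.
  by rewrite -[X in measurable X]setTI; exact: mg.
by apply: eq_bigr => j _; rewrite higherE.
Qed.

End columns.

(** * The moment identity for a single map *)

Section moment.
Context (R : realType) (S : ptopologicalType) (J : countType) (c : J -> S -> R).
Hypothesis cS : lsc_base c.
Local Open Scope ereal_scope.

Let cbS : countably_based S := lsc_base_countably_based cS.
Let cbP : countably_based (Prob R S) := countably_based_prob cS.

Lemma measurable_iid n B : measurable B ->
  measurable_fun setT (fun xi : borel (Prob R S) =>
    iid n (xi : probability (borel S) R) B).
Proof.
apply: (measurable_prod_prob cbS (K := fun _ (xi : borel (Prob R S)) => xi)) => _ A mA.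
exact: (measurable_prob_eval cS mA).
Qed.

Lemma measurable_prod_prob_coord k B : measurable B ->
  measurable_fun setT (fun mu : borel (pow (Prob R S) k) =>
    prod_prob (fun i => mu i : probability (borel S) R) B).
Proof.
apply: (measurable_prod_prob cbS
  (K := fun i (mu : borel (pow (Prob R S) k)) => mu i)) => i A mA.
exact: (measurableT_comp (measurable_prob_eval cS mA) (@measurable_coord _ _ i)).
Qed.

Lemma measurable_higher k (g : pow S k -> S) :
  measurable_fun setT (g : borel (pow S k) -> borel S) ->
  measurable_fun setT
    (higher g : borel (pow (Prob R S) k) -> borel (Prob R S)).
Proof.
move=> mg; apply: (measurable_fun_prob cS) => A mA.
under eq_fun do rewrite (higherE mg)//.
apply: measurable_prod_prob_coord.
by rewrite -[X in measurable X]setTI; exact: mg.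
Qed.

Variable rho : probability (borel (Prob R S)) R.

Lemma momentE n A : measurable A ->
  moment n rho A = \int[rho]_xi iid n (xi : probability (borel S) R) A.
Proof. by move=> mA; apply: mixtureE => // B; exact: measurable_iid. Qed.

(** Given the laws [mu i], a rectangle has mass a product over its rows; integrating the independent
    [mu i] factor by factor turns each one into a moment measure. *)
Lemma iid_moment n k (B : set (borel (pow (pow S n) k))) : measurable B ->
  \int[iid k rho]_mu prod_prob (fun i => iid n (mu i : probability (borel S) R)) B =
  iid k (moment n rho) B.
Proof.
have cbSn : countably_based (pow S n) by exact: countably_based_pow.
have mK A : measurable A -> measurable_fun setT (fun mu : borel (pow (Prob R S) k) =>
    prod_prob (fun i => iid n (mu i : probability (borel S) R)) A).
  apply: (measurable_prod_prob cbSn (K := fun i (mu : borel (pow (Prob R S) k)) =>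
    iid n (mu i : probability (borel S) R))) => i {}A mA.
  exact: (measurableT_comp (measurable_iid mA) (@measurable_coord _ _ i)).
have mK' : measurable_fun setT (fun mu : borel (pow (Prob R S) k) =>
    prod_prob (fun i => iid n (mu i : probability (borel S) R)) :
    giry (borel (pow (pow S n) k)) R).
  exact: measurable_giry_codensity.
move=> mB; rewrite -[LHS](giry_bindE (iid k rho) mK')//.
move: B mB; apply: (prod_prob_unique cbSn (m := giry_bind (iid k rho) mK')) => I A uI mA.
rewrite [LHS]giry_bindE; last exact: measurable_rect.
transitivity (\int[iid k rho]_mu
    \prod_(i <- I) iid n (mu i : probability (borel S) R) (A i)).
  by apply: eq_integral => mu _; exact: prod_probE.
rewrite (integral_prod_prob cbP (fun=> rho)
  (f := fun i (xi : Prob R S) => iid n (xi : probability (borel S) R) (A i)))//.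
- by apply: eq_bigr => i _; rewrite momentE.
- by move=> i; exact: measurable_iid.
Qed.

(** Change of variables along [higher g], then [iid_higher] under the integral, then
    [iid_moment]. *)
Lemma integral_Tmap_higher n k (g : pow S k -> S) A :
  measurable_fun setT (g : borel (pow S k) -> borel S) -> measurable A ->
  \int[Tmap (higher g) rho]_xi iid n (xi : probability (borel S) R) A =
  Tmap (nvariate g) (moment n rho) A.
Proof.
move=> mg mA; have mh := measurable_higher mg.
transitivity (\int[giry_map mh (iid k rho : giry _ R)]_xi
    iid n (xi : probability (borel S) R) A).
  by apply: eq_measure_integral => B mB _; exact: prob_of_pushforward.
rewrite [LHS]giry_int_map//; last exact: measurable_iid.
rewrite [RHS]prob_of_pushforward//; last exact: measurable_nvariate.
rewrite -iid_moment; last first.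
  by rewrite -[X in measurable X]setTI; exact: (measurable_nvariate cbS mg).
by apply: eq_integral => mu _; exact: iid_higher.
Qed.

End moment.

(** * Measurability in the random parameter, and integration over it *)

Section random_map.
Context (R : realType) (S Omega : ptopologicalType) (J : countType) (c : J -> S -> R).
Hypothesis cS : lsc_base c.
Variables (r : probability (borel Omega) R) (kappa : Omega -> enat).
Variable gamma : forall w : Omega, pow S (kappa w) -> S.
Hypothesis mkappa : measurable_fun [set: borel Omega] (kappa : borel Omega -> enat).
Hypothesis mgamma : jointly_measurable gamma.

Let gam (k : enat) : Omega * pow S k -> S := @gamma_at S Omega kappa gamma k.

Lemma gamma_at_kappa w : (fun x => gam (k := kappa w) (w, x)) = @gamma w.
Proof.
apply/funext => x; rewrite /gam /gamma_at /=; case: pselect => [e|//].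
(* Equality on [enat] is decidable, so the cast along a proof of [kappa w = kappa w] is the
   identity. *)
by rewrite (eq_axiomK e).
Qed.

Lemma measurable_kappa k : measurable [set w : borel Omega | kappa w = k].
Proof.
by rewrite -[X in measurable X]setTI; exact: (mkappa measurableT (Y := [set k])).
Qed.

Lemma measurable_gamma_at k : measurable_fun setT
  (gam (k := k) : borel Omega * borel (pow S k) -> borel S).
Proof.
set D := [set w : borel Omega | kappa w = k] `*` [set: borel (pow S k)].
have mD : measurable D by apply: measurableX => //; exact: measurable_kappa.
rewrite -(setUv D); apply/measurable_funU => //; first exact: measurableC.
split; first exact: mgamma.
apply: (eq_measurable_fun (cst point)); last exact: measurable_cst.
move=> [w x]; rewrite inE /D /= => wk; rewrite /gam /gamma_at /=.
by case: pselect => // kw; case: wk.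
Qed.

Lemma measurable_gamma w : measurable_fun setT
  (@gamma w : borel (pow S (kappa w)) -> borel S).
Proof.
rewrite -gamma_at_kappa.
exact (measurableT_comp (@measurable_gamma_at (kappa w))
  (measurable_pair1 (w : borel Omega))).
Qed.

Lemma measurable_higher_gamma_at k : measurable_fun setT
  (fun p : borel Omega * borel (pow (Prob R S) k) =>
    higher (fun x => gam (k := k) (p.1, x)) p.2 : borel (Prob R S)).
Proof.
apply: (measurable_fun_prob cS) => A mA.
have mg w : measurable_fun setT ((fun x => gam (k := k) (w, x)) :
    borel (pow S k) -> borel S).
  exact (measurableT_comp (@measurable_gamma_at k)
    (measurable_pair1 (w : borel Omega))).
under eq_fun do rewrite (higherE (mg _))//.
apply: (measurable_giry_section (f := fst) (C := gam (k := k) @^-1` A)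
  (K := fun p : borel Omega * borel (pow (Prob R S) k) =>
    prod_prob (fun i => p.2 i : probability (borel S) R) : giry (borel (pow S k)) R)).
- exact: measurable_fst.
- apply: measurable_giry_codensity => // B mB.
  exact: (measurableT_comp (measurable_prod_prob_coord cS mB) measurable_snd).
- by rewrite -[X in measurable X]setTI; exact: measurable_gamma_at.
Qed.

(** The domain of [gamma w] varies with [w]. On each of the countably many sets [kappa w = k] the
    function equals [F k], which is measurable on all of [Omega]. *)
Lemma measurable_Tmap_higher (rho : probability (borel (Prob R S)) R) B : measurable B ->
  measurable_fun setT (fun w : borel Omega => Tmap (higher (@gamma w)) rho B).
Proof.
move=> mB.
pose F k (w : borel Omega) := iid k rho
  [set mu | B (higher (fun x => gam (k := k) (w, x)) mu)].
have mF k : measurable_fun setT (F k).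
  apply: (measurable_giry_section (f := id) (K := fun=> iid k rho : giry _ R)
    (C := (fun p : borel Omega * borel (pow (Prob R S) k) =>
      higher (fun x => gam (k := k) (p.1, x)) p.2) @^-1` B)) => //.
  by rewrite -[X in measurable X]setTI; exact: measurable_higher_gamma_at.
have -> : (fun w : borel Omega => Tmap (higher (@gamma w)) rho B) =
    (fun w => F (kappa w) w).
  apply/funext => w; rewrite /F gamma_at_kappa.
  rewrite [LHS]prob_of_pushforward//.
  exact: (measurable_higher cS (@measurable_gamma w)).
move=> _ U mU; rewrite setTI.
have -> : (fun w => F (kappa w) w) @^-1` U =
    \bigcup_k ([set w | kappa w = k] `&` F k @^-1` U).
  by apply/seteqP; split => [w Uw|w [k _ [/= <-]]//]; exists (kappa w).
apply: countable_bigcupT_measurable => [|k]; first exact: (@countableP (option nat)).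
apply: measurableI; first exact: measurable_kappa.
by rewrite -[X in measurable X]setTI; exact: mF.
Qed.

(** Integrating against the mixture is iterated integration, which leaves the single-map identity
    for each [w]. *)
Lemma moment_Tcheck n (rho : probability (borel (Prob R S)) R) :
  moment n (Tcheck r gamma rho) = Tn r gamma (moment n rho).
Proof.
apply: prob_of_ext => A mA.
rewrite (integral_mixture r (fun B mB => measurable_Tmap_higher rho mB))//; last first.
  exact: (measurable_iid cS).
apply: eq_integral => w _; apply: (integral_Tmap_higher cS) => //.
exact: measurable_gamma.
Qed.

End random_map.

Local Close Scope ring_scope.

Theorem lemma2 (R : realType) (S Omega : ptopologicalType)
  (polishS : polish R S) (polishOmega : polish R Omega)
  (r : probability (borel Omega) R)
  (kappa : Omega -> enat) (gamma : forall w : Omega, pow S (kappa w) -> S)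
  (mkappa : measurable_fun [set: borel Omega] (kappa : borel Omega -> enat))
  (mgamma : jointly_measurable gamma)
  (n : enat) (n_gt0 : n <> Some 0)
  (rho : probability (borel (Prob R S)) R) :
  moment n (Tcheck r gamma rho) = Tn r gamma (moment n rho).
Proof.
have [J [c cS]] := lsc_base_polish polishS.
exact: (moment_Tcheck cS).
Qed.
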